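(* For integers $2\leq m\leq n$, the complete bipartite graph $K_{m,n}$ satisfies $tpc(K_{m,n})=3$.
   Context: All graphs are simple, finite and undirected. A graph is total-colored if every vertex and every edge receives a color. A path $v_1v_2\ldots v_s$ in a total-colored graph is a total proper path if (i) any two adjacent edges on the path have different colors, (ii) any two adjacent internal vertices of the path (vertices among $v_2,\ldots,v_{s-1}$) have different colors, and (iii) every internal vertex of the path has a color different from the colors of its two incident edges on the path. A total-colored graph is total proper connected if every two vertices are joined by a total proper path. For a connected graph $G$, the total proper connection number $tpc(G)$ is the smallest number of colors in a total-coloring making $G$ total proper connected. *)

(* Defs.v *)
From mathcomp Require Import all_boot.
Set Implicit Arguments. Unset Strict Implicit. Unset Printing Implicit Defensive.

Record sgraph := SGraph {
  vertex :> finType;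
  adj : rel vertex;
  adj_sym : symmetric adj;
  adj_irrefl : irreflexive adj
}.

Definition edges (G : sgraph) : {set {set G}} :=
  [set [set uv.1; uv.2] | uv in [pred uv : G * G | adj uv.1 uv.2]].

(* [ecol] is a total function on vertex sets, but only its values on [edges G]
   matter: total proper paths and [ncolors] never look at the others. *)
Record tcoloring (G : sgraph) := TColoring {
  vcol : G -> nat;
  ecol : {set G} -> nat
}.

Definition ncolors (G : sgraph) (c : tcoloring G) : nat :=
  size (undup ([seq vcol c x | x : G] ++ [seq ecol c e | e in edges G])).

(* The path has the s = size (x :: q) vertices [v 0], ..., [v s.-1], pairwise
   distinct; the internal ones are [v i] with 0 < i < s.-1. *)
Definition total_proper_path (G : sgraph) (c : tcoloring G) (x y : G)
    (q : seq G) : Prop :=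
  let s := size (x :: q) in
  let v i := nth x (x :: q) i in
  let e i := [set v i; v i.+1] in
  [/\ [/\ path (@adj G) x q, uniq (x :: q) & last x q = y],
      forall i, i.+2 < s -> ecol c (e i) <> ecol c (e i.+1),
      forall i, 0 < i -> i.+1 < s.-1 -> vcol c (v i) <> vcol c (v i.+1)
    & forall i, 0 < i -> i < s.-1 ->
        vcol c (v i) <> ecol c (e i.-1) /\ vcol c (v i) <> ecol c (e i)].

Definition total_proper_connected (G : sgraph) (c : tcoloring G) : Prop :=
  forall x y : G, x != y -> exists q : seq G, total_proper_path c x y q.

(* [is_tpc G k] reads "tpc(G) = k". A relation, since tpc(G) only makes sense
   for connected G; disconnected graphs have no [k]. *)
Definition is_tpc (G : sgraph) (k : nat) : Prop :=
  (exists2 c : tcoloring G, total_proper_connected c & ncolors c = k) /\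
  (forall c : tcoloring G, total_proper_connected c -> k <= ncolors c).

Lemma is_tpc_unique (G : sgraph) (k l : nat) : is_tpc G k -> is_tpc G l -> k = l.
Proof.
move=> [[c Pc <-] minc] [[d Pd <-] mind].
by apply/eqP; rewrite eqn_leq minc // mind.
Qed.

Definition Kadj (m n : nat) : rel ('I_m + 'I_n) := fun u v =>
  match u, v with
  | inl _, inr _ | inr _, inl _ => true
  | _, _ => false
  end.

Lemma Kadj_sym (m n : nat) : symmetric (@Kadj m n).
Proof. by case=> ? [] ?. Qed.

Lemma Kadj_irrefl (m n : nat) : irreflexive (@Kadj m n).
Proof. by case. Qed.

Definition complete_bipartite (m n : nat) : sgraph :=
  SGraph (@Kadj_sym m n) (@Kadj_irrefl m n).

(* Main.v *)
Require Import Defs.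
From mathcomp Require Import all_boot.
Set Implicit Arguments. Unset Strict Implicit. Unset Printing Implicit Defensive.

(** Two vertices on the same side are non-adjacent, so a total proper path
    between them has an internal vertex, whose colour and the colours of its two
    path edges are pairwise distinct: three colours are needed.

    With three colours, the colours read along a total proper path
    (edge, vertex, edge, ...) are 3-periodic.  Let the left vertices be
    l0, l1, ..., coloured 2, 3, 3, ..., and the right ones r0, r1, ..., coloured
    1, 2, 1, ....  The edges at r0 get colours 3, 2, 3, 3, ..., those at r1 get
    1, 1, 3, 3, ..., and all others get 1.  Two right vertices are joined through
    l0 if one of them is r0, and otherwise by the path r l0 r0 l1 r', which reads
    1 2 3 1 2 3 1.  Two left vertices are joined through r0 if one of them is l1,
    through r1 if one of them is l0 and the other is not l1, and otherwise by the
    path l r0 l1 r1 l', which reads 3 1 2 3 1 2 3. *)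

Section TotalProperPath.
Variables (G : sgraph) (c : tcoloring G).
Implicit Types x y z : G.

Lemma total_proper_path_edge x y :
  adj x y -> total_proper_path c x y [:: y].
Proof.
move=> xy; split=> //=; last by case=> [|[|i]].
split=> //; first by rewrite xy.
by rewrite inE andbT; apply: contraL xy => /eqP ->; rewrite adj_irrefl.
Qed.

Lemma total_proper_path_via x z y :
  uniq [:: x; z; y] -> adj x z -> adj z y ->
  uniq [:: ecol c [set x; z]; vcol c z; ecol c [set z; y]] ->
  total_proper_path c x y [:: z; y].
Proof.
move=> Uxzy xz zy; rewrite /= !inE negb_or !andbT.
case/andP=> /andP[/eqP ne_ev /eqP ne_ee] /eqP ne_ve.
split=> /=.
- by rewrite xz zy; split.
- by case.
- by case=> [|[|i]].
- by case=> [|[|i]] // _ _; split=> // /esym.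
Qed.

(** The five triples are the windows of three consecutive colours in the sequence edge, vertex,
    edge, ..., edge. Each condition on a total proper path compares two colours at most two places
    apart, so some window contains it. *)
Lemma total_proper_path_via3 x z1 z2 z3 y :
  uniq [:: x; z1; z2; z3; y] ->
  [/\ adj x z1, adj z1 z2, adj z2 z3 & adj z3 y] ->
  [/\ uniq [:: ecol c [set x; z1]; vcol c z1; ecol c [set z1; z2]],
      uniq [:: vcol c z1; ecol c [set z1; z2]; vcol c z2],
      uniq [:: ecol c [set z1; z2]; vcol c z2; ecol c [set z2; z3]],
      uniq [:: vcol c z2; ecol c [set z2; z3]; vcol c z3] &
      uniq [:: ecol c [set z2; z3]; vcol c z3; ecol c [set z3; y]]] ->
  total_proper_path c x y [:: z1; z2; z3; y].
Proof.
move=> U [a1 a2 a3 a4]; rewrite /= !inE !negb_or !andbT.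
case=> /andP[/andP[/eqP n1 /eqP n2] /eqP n3].
move=> /andP[/andP[/eqP n4 /eqP n5] /eqP n6].
move=> /andP[/andP[/eqP n7 /eqP n8] /eqP n9].
move=> /andP[/andP[/eqP n10 /eqP n11] /eqP n12].
move=> /andP[/andP[/eqP n13 /eqP n14] /eqP n15].
split=> /=.
- by rewrite a1 a2 a3 a4; split.
- by case=> [|[|[|i]]].
- by case=> [|[|[|i]]].
- by case=> [|[|[|[|i]]]] // _ _; split=> // /esym.
Qed.

Lemma total_proper_path_ncolors x y q :
  x != y -> ~~ adj x y -> total_proper_path c x y q -> 2 < ncolors c.
Proof.
move=> neq_xy nadj_xy [[]].
case: q => [|z [|t q]] /=; first by move=> _ _ /eqP; rewrite (negPf neq_xy).
  by rewrite andbT => xz _ zy; rewrite -zy xz in nadj_xy.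
case/and3P=> xz zt _ _ _ Hee _ Hve.
have /= ne_ee := Hee 0 isT.
have /= [ne_ve1 ne_ve2] := Hve 1 isT isT.
pose s := [:: vcol c z; ecol c [set x; z]; ecol c [set z; t]].
have Us : uniq s by rewrite /= !inE negb_or !andbT; apply/andP; split;
  [apply/andP; split|]; apply/eqP.
have edgeP u v : adj u v -> ecol c [set u; v] \in [seq ecol c e | e in edges G].
  by move=> uv; apply: image_f; apply/imsetP; exists (u, v).
apply: (uniq_leq_size Us) => k.
rewrite mem_undup mem_cat !inE => /or3P[] /eqP ->.
- by rewrite image_f.
- by rewrite edgeP ?orbT.
- by rewrite edgeP ?orbT.
Qed.

End TotalProperPath.

Section CompleteBipartite.
Variables m n : nat.
Let K := complete_bipartite m n.

Definition bip_vcol (u : K) : nat :=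
  match u with
  | inl i => if i == 0 :> nat then 2 else 3
  | inr j => if j == 1 :> nat then 2 else 1
  end.

Definition bip_ecol (i j : nat) : nat :=
  match j with
  | 0 => if i == 1 then 2 else 3
  | 1 => if i < 2 then 1 else 3
  | _ => 1
  end.

(* On an edge of [K] the maximum ranges over a single pair. *)
Definition bip_col : tcoloring K :=
  TColoring bip_vcol (fun e : {set K} =>
    \max_(p : 'I_m * 'I_n | e == [set inl p.1; inr p.2]) bip_ecol p.1 p.2).

Lemma ecol_bip_lr (i : 'I_m) (j : 'I_n) :
  ecol bip_col [set inl i; inr j] = bip_ecol i j.
Proof.
rewrite /= (big_pred1 (i, j)) // => -[i' j'] /=.
apply/eqP/eqP=> [eq_e|[-> ->] //].
(* The sides are disjoint, so an edge determines its left and its right end. *)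
have := set21 (inl i : K) (inr j); have := set22 (inl i : K) (inr j).
by rewrite eq_e !inE /= => /eqP[->] /orP[/eqP[->]|].
Qed.

Lemma ecol_bip_rl (i : 'I_m) (j : 'I_n) :
  ecol bip_col [set inr j; inl i] = bip_ecol i j.
Proof. by rewrite setUC ecol_bip_lr. Qed.

Hypotheses (m_gt1 : 1 < m) (n_gt1 : 1 < n).

Let l0 : 'I_m := Ordinal (ltnW m_gt1).
Let l1 : 'I_m := Ordinal m_gt1.
Let r0 : 'I_n := Ordinal (ltnW n_gt1).
Let r1 : 'I_n := Ordinal n_gt1.

Lemma bip_col_connected_left (i i' : 'I_m) :
  i != i' -> exists q, total_proper_path bip_col (inl i : K) (inl i') q.
Proof.
move=> neq_ii'; have neq_nat : i != i' :> nat by [].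
have [i_1|i_1] := boolP ((i == 1 :> nat) || (i' == 1 :> nat)).
  exists [:: inr r0; inl i']; apply: total_proper_path_via => //.
    by rewrite /= !inE /= !andbT.
  rewrite ecol_bip_lr ecol_bip_rl /=.
  by case/orP: i_1 neq_nat => /eqP-> /=; [rewrite eq_sym|] => /negPf->.
(* The pair [l0], [l1] is already settled. It could not go through [r1], where both its edges have
   colour 1. *)
have [i_0|i_0] := boolP ((i == 0 :> nat) || (i' == 0 :> nat)).
  exists [:: inr r1; inl i']; apply: total_proper_path_via => //.
    by rewrite /= !inE /= !andbT.
  rewrite ecol_bip_lr ecol_bip_rl /=.
  by move: neq_nat i_0 i_1; case: (nat_of_ord i) (nat_of_ord i') => [|[|?]] [|[|?]].
exists [:: inr r0; inl l1; inr r1; inl i'].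
move: i_0 i_1; rewrite !negb_or => /andP[i0 i'0] /andP[i1 i'1].
apply: total_proper_path_via3 => //.
  rewrite /= !inE !negb_or /= !andbT; apply/andP; split.
    by apply/andP.
  by rewrite eq_sym.
rewrite !ecol_bip_lr !ecol_bip_rl /=.
move: i0 i'0 i1 i'1.
by case: (nat_of_ord i) (nat_of_ord i') => [|[|?]] [|[|?]].
Qed.

Lemma bip_col_connected_right (j j' : 'I_n) :
  j != j' -> exists q, total_proper_path bip_col (inr j : K) (inr j') q.
Proof.
move=> neq_jj'; have neq_nat : j != j' :> nat by [].
have [j_0|] := boolP ((j == 0 :> nat) || (j' == 0 :> nat)).
  exists [:: inl l0; inr j']; apply: total_proper_path_via => //.
    by rewrite /= !inE /= !andbT.
  rewrite ecol_bip_lr ecol_bip_rl /=.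
  by move: neq_nat j_0; case: (nat_of_ord j) (nat_of_ord j') => [|[|?]] [|[|?]].
rewrite negb_or => /andP[j0 j'0].
(* [r1] is no exception here: all edges from [l0] and [l1] to right vertices other than [r0] have
   colour 1. *)
exists [:: inl l0; inr r0; inl l1; inr j'].
apply: total_proper_path_via3 => //.
  rewrite /= !inE !negb_or /= !andbT; apply/andP; split.
    by apply/andP.
  by rewrite eq_sym.
rewrite !ecol_bip_lr !ecol_bip_rl /=.
by move: j0 j'0; case: (nat_of_ord j) (nat_of_ord j') => [|[|?]] [|[|?]].
Qed.

Lemma bip_col_connected : total_proper_connected bip_col.
Proof.
move=> [i|j] [i'|j'] neq_xy.
- exact: bip_col_connected_left.
- by exists [:: inr j']; apply: total_proper_path_edge.
- by exists [:: inl i']; apply: total_proper_path_edge.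
- exact: bip_col_connected_right.
Qed.

Lemma complete_bipartite_ncolors_ge3 (c : tcoloring K) :
  total_proper_connected c -> 2 < ncolors c.
Proof.
have neq_l : (inl l0 : K) != inl l1 by [].
move=> /(_ _ _ neq_l)[q]; exact: total_proper_path_ncolors.
Qed.

Lemma ncolors_bip_col : ncolors bip_col = 3.
Proof.
(* Connectedness already forces three colours, so it remains to see that every colour lies in
   [[:: 1; 2; 3]]. *)
apply/eqP; rewrite eqn_leq complete_bipartite_ncolors_ge3 ?andbT;
  last exact: bip_col_connected.
apply: (@uniq_leq_size _ _ [:: 1; 2; 3]); first exact: undup_uniq.
have bip_ecol_range i j : bip_ecol i j \in [:: 1; 2; 3].
  by case: j => [|[|j]] //=; case: ifP.
move=> k; rewrite mem_undup mem_cat => /orP[/imageP[[i|j] _ ->]|].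
- by rewrite /=; case: ifP.
- by rewrite /=; case: ifP.
(* Pairs on one side are not edges; the two orientations of an edge remain. *)
case/imageP=> e /imsetP[[[i|j] [i'|j']] // _ ->] ->.
- by rewrite ecol_bip_lr.
- by rewrite ecol_bip_rl.
Qed.

End CompleteBipartite.

Theorem theorem2 (m n : nat) (hm : 2 <= m) (hmn : m <= n) :
  is_tpc (complete_bipartite m n) 3.
Proof.
have hn : 2 <= n := leq_trans hm hmn.
split; last exact: complete_bipartite_ncolors_ge3.
exists (bip_col m n); [exact: bip_col_connected | exact: ncolors_bip_col].
Qed.
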